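(* Let $X$ be a locally compact space, $\kappa$ a strictly positive definite kernel on $X$, $\mathbf A=(A_i)_{i\in I}$ a generalized condenser in $X$ with $c_\kappa(A_i)>0$ for all $i\in I$, $\mathbf a=(a_i)_{i\in I}$ with $a_i\in(0,\infty)$, $\mathbf f=(f_i)_{i\in I}$ an external field, and $\boldsymbol\xi=(\xi^i)_{i\in I}$ a constraint (all as described in the context). Then any two solutions $\boldsymbol\lambda,\breve{\boldsymbol\lambda}\in\mathfrak S^{\boldsymbol\xi}_{\kappa,\mathbf f}(\mathbf A,\mathbf a;X)$ are $R$-equivalent, i.e. $\sum_{i\in I}s_i\lambda^i=\sum_{i\in I}s_i\breve\lambda^i$.
   Context: $X$ is a locally compact Hausdorff space, metrizable and countable at infinity. A kernel $\kappa$ on $X$ is a symmetric lower semicontinuous function $X\times X\to[0,\infty]$. For signed Radon measures $\mu,\nu$ on $X$, $\kappa(\mu,\nu)=\iint\kappa(x,y)\,d\mu(x)\,d\nu(y)$ (when well defined). $\kappa$ is strictly positive definite if $\kappa(\mu,\mu)\geqslant0$ for every signed Radon measure $\mu$ for which it is well defined, and $\kappa(\mu,\mu)>0$ unless $\mu=0$. $\mathfrak M^+(Q;X)$ is the set of positive Radon measures $\mu$ on $X$ carried by $Q$ (i.e. $X\setminus Q$ is $\mu$-negligible), and $\mathcal E^+_\kappa(Q;X)$ the set of those with $\kappa(\mu,\mu)<\infty$. $c_\kappa(Q)=[\inf\{\kappa(\mu,\mu):\mu\in\mathcal E^+_\kappa(Q;X),\mu(Q)=1\}]^{-1}$ ($\inf\varnothing=+\infty$,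 $1/(+\infty)=0$, $1/0=+\infty$). A generalized condenser is an ordered finite collection $\mathbf A=(A_i)_{i\in I}$ ($I\neq\varnothing$) of nonempty locally closed subsets of $X$ (intersections of an open and a closed set), with signs $s_i=\pm1$, such that $A_i\cap A_j=\varnothing$ whenever $s_is_j=-1$. $\mathcal E^+_\kappa(\mathbf A;X)=\prod_{i\in I}\mathcal E^+_\kappa(A_i;X)$. For $\boldsymbol\mu=(\mu^i)_{i\in I}$ in it, $\kappa(\boldsymbol\mu,\boldsymbol\mu)=\sum_{i,j\in I}s_is_j\kappa(\mu^i,\mu^j)$. The external field: $f_i:X\to[-\infty,\infty]$ is $\mu$-measurable for every $\mu\in\mathcal E^+_\kappa(A_i;X)$; $G_{\kappa,\mathbf f}(\boldsymbol\mu)=\kappa(\boldsymbol\mu,\boldsymbol\mu)+2\sum_{i\in I}\int f_i\,d\mu^i$. The constraint: for each $i\in I$ either $\xi^i\in\mathfrak M^+(A_i;X)$ with $\xi^i(A_i)>a_i$, or $\xi^i=\infty$ (meaning no upper constraint on $\mu^i$). $\mathcal E^{\boldsymbol\xi}_{\kappa,\mathbf f}(\mathbf A,\mathbf a;X)$ is the set of $\boldsymbol\mu\in\mathcal E^+_\kappa(\mathbf A;X)$ with $\mu^i(A_i)=a_i$, $\mu^i\leqslant\xi^i$ for all $i\in I$ and $G_{\kappa,\mathbf f}(\boldsymbol\mu)$ finite; $\mathfrak S^{\boldsymbol\xi}_{\kappa,\mathbf f}(\mathbf A,\mathbf a;X)$ is the set of its elements minimizing $G_{\kappa,\mathbf f}$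 over it. $\boldsymbol\mu,\boldsymbol\mu_1$ are $R$-equivalent if $R\boldsymbol\mu=R\boldsymbol\mu_1$, where $R\boldsymbol\mu=\sum_{i\in I}s_i\mu^i$. *)

(* Defs.v *)
From HB Require Import structures.
From mathcomp Require Import all_boot all_order all_algebra.
From mathcomp Require Import all_classical all_reals all_analysis.
From mathcomp Require Import measurable_realfun.

Set Implicit Arguments.
Unset Strict Implicit.
Unset Printing Implicit Defensive.

Import Order.TTheory GRing.Theory Num.Theory.
Import numFieldNormedType.Exports.

Local Open Scope classical_set_scope.
Local Open Scope ring_scope.
Local Open Scope ereal_scope.

Definition metrizable (R : realType) (X : topologicalType) : Prop :=
  exists (M : metricType R) (f : X -> M) (g : M -> X),
    [/\ cancel f g, cancel g f, continuous f & continuous g].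

Definition countable_at_infinity (X : topologicalType) : Prop :=
  exists2 K : nat -> set X, (forall n, compact (K n)) & \bigcup_n K n = setT.

Definition locally_closed (X : topologicalType) (A : set X) : Prop :=
  exists U F : set X, [/\ open U, closed F & A = U `&` F].

(* [X] with its Borel sigma-algebra.  The library's measurable types are
   pointed, whence [ptopologicalType]. *)
Notation borel X := (g_sigma_algebraType (@open X)).

Section potential_theory.
Variables (R : realType) (X : ptopologicalType).

Local Notation meas := {measure set (borel X) -> \bar R}.

(* A positive Radon measure, as a Borel measure which is finite on compact
   sets and inner regular with respect to them. *)
Definition radon (mu : meas) : Prop :=
  (forall K : set X, compact K -> mu K < +oo) /\
  (forall B : set (borel X), measurable B ->
    mu B = ereal_sup [set mu K | K in [set K : set X | compact K /\ K `<=` B]]).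

(* A signed Radon measure may have infinite positive and infinite negative
   variation, hence need not be a charge.  It is given here by its (unique)
   Jordan decomposition into mutually singular positive Radon measures. *)
Record signed_radon := SignedRadon {
  pos_part : meas;
  neg_part : meas;
  pos_part_radon : radon pos_part;
  neg_part_radon : radon neg_part;
  parts_singular : exists N : set (borel X),
    [/\ measurable N, pos_part N = 0 & neg_part (~` N) = 0] }.

Definition null_signed (m : signed_radon) : Prop :=
  forall B : set (borel X), measurable B -> pos_part m B = 0 /\ neg_part m B = 0.

Definition is_kernel (k : X * X -> \bar R) : Prop :=
  [/\ forall p, 0 <= k p,
      forall x y, k (x, y) = k (y, x) &
      lower_semicontinuous k].

Section energies.
Variable k : X * X -> \bar R.

Definition mutual_energy (mu nu : meas) : \bar R :=
  \int[nu]_y \int[mu]_x k (x, y).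

(* The contributions to the energy of a signed measure of the positive and of
   the negative part of its tensor square; the energy is well defined when
   their difference is not of the form +oo - +oo. *)
Definition energy_pos (m : signed_radon) : \bar R :=
  mutual_energy (pos_part m) (pos_part m) +
  mutual_energy (neg_part m) (neg_part m).

Definition energy_neg (m : signed_radon) : \bar R :=
  mutual_energy (pos_part m) (neg_part m) +
  mutual_energy (neg_part m) (pos_part m).

Definition energy_well_defined (m : signed_radon) : Prop :=
  energy_pos m < +oo \/ energy_neg m < +oo.

Definition signed_energy (m : signed_radon) : \bar R :=
  energy_pos m - energy_neg m.

Definition strictly_positive_definite : Prop :=
  forall m : signed_radon, energy_well_defined m ->
    0 <= signed_energy m /\ (~ null_signed m -> 0 < signed_energy m).

Definition radon_on (Q : set X) (mu : meas) : Prop :=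
  radon mu /\ mu.-negligible (~` Q).

Definition finite_energy_on (Q : set X) (mu : meas) : Prop :=
  radon_on Q mu /\ mutual_energy mu mu < +oo.

(* The library's conventions [ereal_inf set0 = +oo], [+oo^-1 = 0] and
   [0^-1 = +oo] are the intended ones. *)
Definition capacity (Q : set X) : \bar R :=
  (ereal_inf [set mutual_energy mu mu |
     mu in [set mu : meas | finite_energy_on Q mu /\ mu Q = 1]])^-1.

(* Measurability with respect to the completion of [mu]. *)
Definition mu_measurable (mu : meas) (f : X -> \bar R) : Prop :=
  measurable_fun [set: g_sigma_algebraType (completed_algebra_gen mu)]
    (f : g_sigma_algebraType (completed_algebra_gen mu) -> \bar R).

Section condensers.
Variable I : finType.

Definition generalized_condenser (A : I -> set X) (s : I -> R) : Prop :=
  [/\ (0 < #|I|)%N,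
      forall i, locally_closed (A i) /\ A i !=set0,
      forall i, s i = 1%R \/ s i = (-1)%R &
      forall i j, (s i * s j = -1)%R -> A i `&` A j = set0].

Definition external_field (A : I -> set X) (f : I -> X -> \bar R) : Prop :=
  forall i mu, finite_energy_on (A i) mu -> mu_measurable mu (f i).

(* [None] stands for the absence of an upper constraint. *)
Definition is_constraint (A : I -> set X) (a : I -> R) (xi : I -> option meas)
    : Prop :=
  forall i x, xi i = Some x -> radon_on (A i) x /\ (a i)%:E < x (A i).

Definition below_constraint (mu : meas) (x : option meas) : Prop :=
  if x is Some xi then
    forall B : set (borel X), measurable B -> mu B <= xi B
  else True.

Definition vector_energy (s : I -> R) (mu : I -> meas) : \bar R :=
  \sum_(i : I) \sum_(j : I) (s i * s j)%:E * mutual_energy (mu i) (mu j).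

(* In [\bar R], [+oo - +oo = -oo], and a finite sum is a finite number only if
   each of its terms is; hence this value is finite exactly when all mutual
   energies involved are finite and each [f i] is [mu i]-integrable. *)
Definition gauss (s : I -> R) (f : I -> X -> \bar R) (mu : I -> meas) : \bar R :=
  vector_energy s mu + 2%:E * \sum_(i : I) \int[mu i]_x f i x.

Definition admissible (A : I -> set X) (s : I -> R) (a : I -> R)
    (f : I -> X -> \bar R) (xi : I -> option meas) : set (I -> meas) :=
  [set mu | [/\ forall i, finite_energy_on (A i) (mu i),
                forall i, mu i (A i) = (a i)%:E,
                forall i, below_constraint (mu i) (xi i) &
                gauss s f mu \is a fin_num]].

Definition solutions (A : I -> set X) (s : I -> R) (a : I -> R)
    (f : I -> X -> \bar R) (xi : I -> option meas) : set (I -> meas) :=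
  [set lam | admissible A s a f xi lam /\
    forall mu, admissible A s a f xi mu -> gauss s f lam <= gauss s f mu].

(* The signed measure [R mu] as a set function.  It is meant for vectors of
   finite measures, such as the admissible ones, whose components have total
   mass [a i]; no indeterminate sum then occurs. *)
Definition resultant (s : I -> R) (mu : I -> meas) (B : set (borel X)) : \bar R :=
  \sum_(i : I) (s i)%:E * mu i B.

Definition R_equivalent (s : I -> R) (mu nu : I -> meas) : Prop :=
  forall B : set (borel X), measurable B -> resultant s mu B = resultant s nu B.

End condensers.
End energies.
End potential_theory.

(* Main.v *)
Require Import Defs.
From HB Require Import structures.
From mathcomp Require Import finmap all_boot all_order all_algebra.
From mathcomp Require Import all_classical all_reals all_analysis.
From mathcomp Require Import measurable_realfun lra.

(** Let [lam], [lam'] be two solutions.  Strict positive definiteness makes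
    all mutual energies finite, so the componentwise midpoint of [lam] and
    [lam'] is again admissible.  The field terms are affine, so comparing the
    Gauss functional at the midpoint with its values at [lam] and [lam'] and
    using the parallelogram identity, the energy of the signed measure
    [R lam - R lam'] is nonpositive; hence that measure is zero.

    To speak of this energy the signed measure has to be replaced by its Jordan
    decomposition.  It is a difference [m - n] of finite positive Radon
    measures, and [m = p + r], [n = q + r] with [p], [q] mutually singular; by
    bilinearity the common part [r] cancels.  Bilinearity needs the
    kernel to be measurable for the product of the Borel sigma-algebras, which
    holds because [X] is second countable. *)

Set Implicit Arguments.
Unset Strict Implicit.
Unset Printing Implicit Defensive.

Import Order.TTheory GRing.Theory Num.Theory.
Import numFieldNormedType.Exports.
Import HBNNSimple.

Local Open Scope classical_set_scope.
Local Open Scope ring_scope.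
Local Open Scope ereal_scope.

(** * Second countability and product measurability of the kernel *)

(** Small metric balls are pulled back along [f]. For each radius finitely many of them cover the
    compact set [K n], and all these finite families together form a countable basis. *)
Lemma sigma_compact_metrizable_second_countable (R : realType)
    (X : ptopologicalType) :
  metrizable R X -> countable_at_infinity X -> @second_countable X.
Proof.
move=> [M [f [g [fK gK cf cg]]]] [K cK KT].
pose V (m : nat) (c : X) : set X := f @^-1` (ball (f c) m.+1%:R^-1)°.
have V_open m c : open (V m c).
  by apply: open_comp; [move=> x _; exact: cf|exact: open_interior].
have V_center m c : V m c c by rewrite /V /= /interior; exact: nbhsx_ballx.
have cover_K n m : finite_subset_cover (K n) (V m) (K n).
  have: cover_compact (K n) by rewrite -compact_cover.
  apply; first by move=> *; exact: V_open.
  by move=> x Kx; exists x.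
have /choice[D D_cover] (nm : nat * nat) :
    exists D : {fset X}, K nm.1 `<=` cover [set` D] (V nm.2).
  by have [D _] := cover_K nm.1 nm.2; exists D.
exists (\bigcup_n \bigcup_m V m @` [set` D (n, m)]); last split.
- apply: bigcup_countable => // n _; apply: bigcup_countable => // m _.
  by apply/finite_set_countable/finite_image/finite_fset.
- by move=> _ [n _ [m _ [c _ <-]]].
- move=> x U Ux.
  have /nbhs_ballP[e e0 eU] : nbhs (f x) (g @^-1` U).
    by apply: cg; rewrite fK.
  have e2 : (0 < e / 2)%R by rewrite divr_gt0.
  (* Two points of one set [V m c] are both within 1/(m+1) of [f c], so a radius below [e / 2] keeps
     them within [e] of each other. *)
  have [m] := ltr_add_invr e2; rewrite add0r => me.
  have [n _ Kx] : (\bigcup_n K n) x by rewrite KT.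
  have [c cD Vx] := D_cover (n, m) x Kx.
  exists (V m c) => /=; first split=> //.
    by exists n => //; exists m => //; exists c.
  move=> y Vy; rewrite -(fK y); apply: eU; rewrite (splitr e).
  apply: (@ball_triangle _ _ (f c)).
  + by apply: (le_ball (ltW me)); apply/ball_sym; exact: interior_subset Vx.
  + by apply: (le_ball (ltW me)); exact: interior_subset Vy.
Qed.

(** An open set of the product is the union of the basic rectangles inside it; a countable basis
    leaves only countably many of them. *)
Lemma open_prod_measurable (X : ptopologicalType) (O : set (X * X)) :
  @second_countable X -> open O -> measurable (O : set (borel X * borel X)).
Proof.
move=> [B cB [B_open B_basis]] oO.
pose D := [set UV | [/\ B UV.1, B UV.2 & UV.1 `*` UV.2 `<=` O]].
have -> : O = \bigcup_(UV in D) (UV.1 `*` UV.2).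
  apply/seteqP; split=> [[x y] Oxy|[x y] [[U V] [_ _ UVO] /UVO //]].
  have [[P Q] [/= Px Qy] PQO] : nbhs (x, y) O by exact: open_nbhs_nbhs.
  have [U [BU Ux] UP] := B_basis x P Px.
  have [V [BV Vy] VQ] := B_basis y Q Qy.
  exists (U, V) => //; split => //= -[p q] [/= Up Vq].
  by apply: PQO; split; [exact: UP|exact: VQ].
rewrite bigcup_set_type; apply: countable_bigcupT_measurable.
  rewrite (eq_countable (card_setT _)).
  apply: sub_countable (countableX cB cB); apply: subset_card_le.
  by move=> [U V] [BU BV _].
move=> [UV /set_mem[BU BV _]] /=.
by apply: measurableX; apply: sub_sigma_algebra; exact: B_open.
Qed.

Lemma lower_semicontinuous_prod_measurable (R : realType) (X : ptopologicalType)
    (k : X * X -> \bar R) :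
  @second_countable X -> lower_semicontinuous k ->
  measurable_fun [set: borel X * borel X] (k : borel X * borel X -> \bar R).
Proof.
move=> scX /lower_semicontinuousP lsck.
apply: (measurability _ (ErealGenOInfty.measurableE R)) => _ [_ [a ->]] <-.
rewrite setTI preimage_itvoy; exact: open_prod_measurable (lsck a).
Qed.

(** * Sums of measures and Jordan decomposition *)

(** A relation rather than an operation, so that it also applies to splittings of a given measure,
    such as [m = p + r] or twice a midpoint. *)
Definition measure_sum d (T : measurableType d) (R : realType)
    (m m1 m2 : {measure set T -> \bar R}) :=
  forall B, measurable B -> m B = m1 B + m2 B.

(** Since both sets contain 0, a finite [z] bounds each of them separately; everything is then
    finite and terms can be moved across the inequality. *)
Lemma ge0_ereal_supD_le (R : realType) (S1 S2 : set \bar R) (z : \bar R) :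
  S1 0 -> S2 0 -> (forall x, S1 x -> 0 <= x) ->
  (forall x y, S1 x -> S2 y -> x + y <= z) -> ereal_sup S1 + ereal_sup S2 <= z.
Proof.
move=> S10 S20 S1_ge0 S12z.
have z_ge0 : 0 <= z by rewrite -(adde0 0); exact: S12z.
have [->|z_fin] := eqVneq z +oo; first by rewrite leey.
have {}z_fin : z \is a fin_num by rewrite ge0_fin_numE// lt_neqAle z_fin leey.
have fin0z x : 0 <= x -> x <= z -> x \is a fin_num.
  by move=> x0 xz; rewrite ge0_fin_numE// (le_lt_trans xz)// ltey_eq z_fin.
have supS2_fin : ereal_sup S2 \is a fin_num.
  apply: fin0z; first exact: ereal_sup_ubound.
  by apply: ge_ereal_sup => y S2y; rewrite -(add0e y); exact: S12z.
rewrite -leeBrDr//; apply: ge_ereal_sup => x S1x; rewrite leeBrDr// -leeBrDl.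
  apply: ge_ereal_sup => y S2y; rewrite leeBrDl ?S12z//.
  by apply: fin0z; [exact: S1_ge0|rewrite -(adde0 x); exact: S12z].
by apply: fin0z; [exact: S1_ge0|rewrite -(adde0 x); exact: S12z].
Qed.

(* [f] may be non-measurable: an external field is only measurable for the
   completions.  Its integral is then still a supremum over the simple functions
   below it, and two minorants are dominated by their maximum. *)
Lemma ge0_integral_measure_sum2 d (T : measurableType d) (R : realType)
    (m m1 m2 : {measure set T -> \bar R}) (f : T -> \bar R) :
  measure_sum m m1 m2 -> (forall x, 0 <= f x) ->
  \int[m]_x f x = \int[m1]_x f x + \int[m2]_x f x.
Proof.
move=> mE f0.
have sE (h : {nnsfun T >-> R}) :
    sintegral m h = sintegral m1 h + sintegral m2 h.
  rewrite -!integralT_nnsfun -integral_measure_add_nnsfun//.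
  apply: eq_measure_integral => B mB _.
  by rewrite mE// -measure_addE.
apply/eqP; rewrite eq_le; apply/andP; split.
  rewrite [leLHS]ge0_integralTE//; apply: ge_ereal_sup => _ [h hf <-].
  rewrite sE; apply: leeD; rewrite ge0_integralTE//;
    by apply: ereal_sup_ubound; exists h.
rewrite (ge0_integralTE m1)// (ge0_integralTE m2)//; apply: ge0_ereal_supD_le.
- by exists nnsfun0 => //; exact: sintegral0.
- by exists nnsfun0 => //; exact: sintegral0.
- by move=> _ [h _ <-]; exact: sintegral_ge0.
move=> _ _ [h1 h1f <-] [h2 h2f <-].
apply: (@le_trans _ _ (sintegral m (max_nnsfun h1 h2))).
  rewrite sE; apply: leeD; apply: le_sintegral => x /=;
    by rewrite le_max lexx ?orbT.
rewrite ge0_integralTE//; apply: ereal_sup_ubound.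
exists (max_nnsfun h1 h2) => //= x.
by rewrite EFin_max ge_max h1f h2f.
Qed.

Lemma integral_measure_sum2 d (T : measurableType d) (R : realType)
    (m m1 m2 : {measure set T -> \bar R}) (f : T -> \bar R) :
  measure_sum m m1 m2 ->
  \int[m1]_x f x \is a fin_num -> \int[m2]_x f x \is a fin_num ->
  \int[m]_x f x = \int[m1]_x f x + \int[m2]_x f x.
Proof.
move=> mE; rewrite (integralE m) (integralE m1) (integralE m2).
rewrite !(ge0_integral_measure_sum2 mE)//.
move: (\int[m1]_x f^\+ x) (\int[m1]_x f^\- x) => a b.
move: (\int[m2]_x f^\+ x) (\int[m2]_x f^\- x) => c e.
by rewrite !fin_numB => /andP[? ?] /andP[? ?]; rewrite fin_num_oppeD// addeACA.
Qed.

(** An integral is finite exactly when those of [f^\+] and [f^\-] are, and both are additive in the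
    measure. *)
Lemma integral_measure_sum2_fin_num d (T : measurableType d) (R : realType)
    (m m1 m2 : {measure set T -> \bar R}) (f : T -> \bar R) :
  measure_sum m m1 m2 ->
  \int[m]_x f x \is a fin_num =
  (\int[m1]_x f x \is a fin_num) && (\int[m2]_x f x \is a fin_num).
Proof.
move=> mE; rewrite (integralE m) (integralE m1) (integralE m2).
rewrite !(ge0_integral_measure_sum2 mE)//.
move: (\int[m1]_x f^\+ x) (\int[m1]_x f^\- x) => a b.
move: (\int[m2]_x f^\+ x) (\int[m2]_x f^\- x) => c e.
by rewrite !fin_numB !fin_numD andbACA.
Qed.

(* A copy of [m], so that finiteness can be attached to it as a structure. *)
Definition finite_copy d (T : measurableType d) (R : realType)
  (m : {measure set T -> \bar R}) (mT : m setT < +oo) : set T -> \bar R := m.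

Section finite_copy.
Context d (T : measurableType d) (R : realType).
Variables (m : {measure set T -> \bar R}) (mT : m setT < +oo).

HB.instance Definition _ := Measure.on (finite_copy mT).

Let finite_copy_fin_num : fin_num_fun (finite_copy mT).
Proof.
move=> B mB; rewrite ge0_fin_numE//; apply: le_lt_trans mT.
by apply: le_measure => //; rewrite inE.
Qed.

HB.instance Definition _ := @Measure_isFinite.Build _ _ _
  (finite_copy mT) finite_copy_fin_num.

End finite_copy.

Lemma finite_measureP d (T : measurableType d) (R : realType)
    (m : {measure set T -> \bar R}) :
  m setT < +oo ->
  exists m' : {finite_measure set T -> \bar R},
    m = m' :> {measure set T -> \bar R}.
Proof. by move=> mT; exists (finite_copy mT); exact: eq_measure. Qed.

(** With a Hahn decomposition [P], [N] of [m - n], the measure [p] is [m - n] on [P], [q] is [n - m]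
    on [N], and the common part [r] is the infimum of [m] and [n]: it equals [n] on [P] and [m] on
    [N]. *)
Lemma jordan_finite_measures d (T : measurableType d) (R : realType)
    (m n : {measure set T -> \bar R}) :
  m setT < +oo -> n setT < +oo ->
  exists p q r : {measure set T -> \bar R},
    [/\ measure_sum m p r, measure_sum n q r &
        exists N, [/\ measurable N, p N = 0 & q (~` N) = 0]].
Proof.
move=> /finite_measureP[{}m ->] /finite_measureP[{}n ->].
pose nu : {charge set T -> \bar R} := cadd (charge_of_finite_measure m)
  (cscale (-1) (charge_of_finite_measure n)).
have [P [N hPN]] := Hahn_decomposition nu.
have [[mP _] [mN _] PNT PN0] := hPN.
have nuE B : nu B = m B - n B by rewrite /nu /= /cadd /= cscaleN1.
have restrE (k : {finite_measure set T -> \bar R}) B : measurable B ->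
    k B = k (B `&` P) + k (B `&` N).
  move=> mB; rewrite -measureU; try exact: measurableI.
    by rewrite -setIUr PNT setIT.
  by rewrite setIACA PN0 setI0.
have fin (k : {finite_measure set T -> \bar R}) B C : measurable B ->
    measurable C -> k (B `&` C) \is a fin_num.
  by move=> mB mC; rewrite fin_num_measure//; exact: measurableI.
pose r : {measure set T -> \bar R} := measure_add (mrestr n mP) (mrestr m mN).
have rE B : r B = n (B `&` P) + m (B `&` N).
  exact: (measure_addE (mrestr n mP) (mrestr m mN)).
pose p : {measure set T -> \bar R} := jordan_pos hPN.
pose q : {measure set T -> \bar R} := jordan_neg hPN.
have pE B : measurable B -> p B = nu (B `&` P).
  move=> mB; transitivity (jordan_pos hPN B) => //.
  by rewrite jordan_posE cjordan_posE /crestr0 mem_set.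
have qE B : measurable B -> q B = - nu (B `&` N).
  move=> mB; transitivity (jordan_neg hPN B) => //.
  by rewrite jordan_negE cjordan_negE /crestr0 mem_set.
exists p, q, r; split.
- by move=> B mB; rewrite pE// rE nuE addeA subeK ?fin// -restrE.
- move=> B mB; rewrite qE// rE nuE fin_num_oppeB ?fin// (addeC (- _)).
  by rewrite (addeC (n (B `&` P))) addeA subeK ?fin// addeC -restrE.
- exists N; split => //; first by rewrite pE// setIC PN0 charge0.
  by rewrite qE ?setICl ?charge0 ?oppe0//; exact: measurableC.
Qed.

(** * Finite Radon measures *)

Section radon_measures.
Context (R : realType) (X : ptopologicalType).
Hypothesis hausdorffX : hausdorff_space X.
Local Notation meas := {measure set (borel X) -> \bar R}.
Implicit Types (m : meas) (B : set (borel X)).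

Lemma open_borel (U : set X) : open U -> measurable (U : set (borel X)).
Proof. exact: sub_sigma_algebra. Qed.

Lemma closed_borel (F : set X) : closed F -> measurable (F : set (borel X)).
Proof.
move=> cF; rewrite -[F]setCK; apply: (@measurableC _ (borel X)).
by apply: open_borel; exact: closed_openC.
Qed.

Lemma compact_borel (K : set X) : compact K -> measurable (K : set (borel X)).
Proof. by move=> cK; apply: closed_borel; exact: compact_closed. Qed.

Lemma locally_closed_borel (A : set X) :
  locally_closed A -> measurable (A : set (borel X)).
Proof.
move=> [U [F [oU cF ->]]].
by apply: measurableI; [exact: open_borel|exact: closed_borel].
Qed.

Lemma fin_num_le_setT m B : m setT < +oo -> measurable B -> m B \is a fin_num.
Proof.
move=> mT mB; rewrite ge0_fin_numE//; apply: le_lt_trans mT.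
by apply: le_measure => //; rewrite inE.
Qed.

Lemma finite_radonP m : m setT < +oo ->
  radon m <-> forall B (e : R), measurable B -> (0 < e)%R ->
    exists K : set X, [/\ compact K, K `<=` B & m (B `\` K) <= e%:E].
Proof.
move=> mT; have fin := fin_num_le_setT mT; split.
  move=> [_ m_sup] B e mB e0.
  have sup_fin : ereal_sup [set m K | K in [set K | compact K /\ K `<=` B]]
    \is a fin_num by rewrite -m_sup// fin.
  have [_ [K [cK KB] <-]] := ub_ereal_sup_adherent e0 sup_fin.
  rewrite -m_sup// => mK; have mK' := compact_borel cK.
  exists K; split=> //; rewrite measureD//; last by rewrite -ge0_fin_numE ?fin.
  by rewrite (setIidr KB) leeBlDr ?fin// -leeBlDl ?fin// ltW.
move=> m_inner; split=> [K cK|B mB].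
  by rewrite -ge0_fin_numE ?fin//; exact: compact_borel.
apply/eqP; rewrite eq_le; apply/andP; split.
  apply/lee_addgt0Pr => e e0.
  have [K [cK KB mBK]] := m_inner B e mB e0; have mK := compact_borel cK.
  rewrite -(setDUK KB) measureU//;
    [|exact: measurableD|by rewrite setDE setICA setICr setI0].
  by apply: leeD => //; apply: ereal_sup_ubound; exists K.
apply: ge_ereal_sup => _ [K [cK KB] <-].
by apply: le_measure => //; rewrite inE//; exact: compact_borel.
Qed.

Lemma radon_le m1 m2 : m2 setT < +oo ->
  (forall B, measurable B -> m1 B <= m2 B) -> radon m2 -> radon m1.
Proof.
move=> m2T m12; have m1T : m1 setT < +oo by apply: le_lt_trans m2T; exact: m12.
move=> /(finite_radonP m2T) m2_inner; apply/(finite_radonP m1T) => B e mB e0.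
have [K [cK KB mBK]] := m2_inner B e mB e0; exists K; split=> //.
apply: le_trans mBK; apply: m12.
by apply: measurableD => //; exact: compact_borel.
Qed.

Lemma radon_sum m m1 m2 : m1 setT < +oo -> m2 setT < +oo ->
  measure_sum m m1 m2 -> radon m1 -> radon m2 -> radon m.
Proof.
move=> m1T m2T mE; have mT : m setT < +oo by rewrite mE// lte_add_pinfty.
move=> /(finite_radonP m1T) m1_inner /(finite_radonP m2T) m2_inner.
apply/(finite_radonP mT) => B e mB e0.
have e2 : (0 < e / 2)%R by rewrite divr_gt0.
have [K1 [cK1 K1B mBK1]] := m1_inner B _ mB e2.
have [K2 [cK2 K2B mBK2]] := m2_inner B _ mB e2.
have [mK1 mK2] := (compact_borel cK1, compact_borel cK2).
have mK12 := measurableU _ _ mK1 mK2.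
exists (K1 `|` K2); split; [exact: compactU|by rewrite subUset|].
have le_remainder m' (K' : set (borel X)) :
    measurable K' -> K' `<=` K1 `|` K2 ->
    m' (B `\` (K1 `|` K2)) <= m' (B `\` K').
  move=> mK' K'K; apply: le_measure; last exact: setDS.
    by rewrite inE; exact: measurableD.
  by rewrite inE; exact: measurableD.
rewrite mE; last exact: measurableD.
rewrite (splitr e) EFinD; apply: leeD.
  by apply: le_trans mBK1; apply: le_remainder => // x; left.
by apply: le_trans mBK2; apply: le_remainder => // x; right.
Qed.

Lemma measure_sum_le m m1 m2 B :
  measure_sum m m1 m2 -> measurable B -> m1 B <= m B.
Proof. by move=> mE mB; rewrite mE// leeDl. Qed.

End radon_measures.

(** * Bilinearity of the mutual energy *)

Section mutual_energy.
Context (R : realType) (X : ptopologicalType) (k : X * X -> \bar R).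
Hypothesis mk :
  measurable_fun [set: borel X * borel X] (k : borel X * borel X -> \bar R).
Hypothesis k_ge0 : forall p, 0 <= k p.
Local Notation meas := {measure set (borel X) -> \bar R}.
Local Notation energy := (mutual_energy k).
Implicit Types m n : meas.

Lemma mutual_energy_ge0 m n : 0 <= energy m n.
Proof. by apply: integral_ge0 => y _; exact: integral_ge0. Qed.

Lemma measurable_potential m : m setT < +oo ->
  measurable_fun [set: borel X] (fun y : borel X => \int[m]_x k (x, y)).
Proof.
move=> /finite_measureP[m' ->].
exact: (@measurable_fun_fubini_tonelli_G
  _ _ (borel X) (borel X) R m' k mk k_ge0).
Qed.

(** Here the inner integral splits first, and splitting the outer one then requires measurable
    potentials, which Tonelli gives for finite measures. In the right argument additivity of the
    outer integral suffices. *)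
Lemma mutual_energyDl m m1 m2 n : m1 setT < +oo -> m2 setT < +oo ->
  measure_sum m m1 m2 -> energy m n = energy m1 n + energy m2 n.
Proof.
move=> m1T m2T mE; rewrite /mutual_energy -ge0_integralD//.
- by apply: eq_integral => y _; exact: ge0_integral_measure_sum2.
- by move=> y _; exact: integral_ge0.
- exact: measurable_potential.
- by move=> y _; exact: integral_ge0.
- exact: measurable_potential.
Qed.

Lemma mutual_energyDr m m1 m2 n : measure_sum m m1 m2 ->
  energy n m = energy n m1 + energy n m2.
Proof.
by move=> mE; apply: ge0_integral_measure_sum2 => // y; exact: integral_ge0.
Qed.

End mutual_energy.

(** * Consequences of strict positive definiteness *)

Lemma ge0_adde_lty (R : realDomainType) (x y : \bar R) :
  0 <= x -> 0 <= y -> (x + y < +oo) = (x < +oo) && (y < +oo).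
Proof. by move=> x0 y0; rewrite -!ge0_fin_numE ?adde_ge0// fin_numD. Qed.

(* Here and below [pq] stands for the mutual energy of [p] and [q], and so on;
   the measures [m = p + r] and [n = q + r] have [r] as their common part. *)
Lemma cross_energy_lty (R : realDomainType)
    (pp pq pr qp qq qr rp rq rr : \bar R) :
  0 <= pp -> 0 <= pq -> 0 <= pr -> 0 <= qp -> 0 <= qq -> 0 <= qr -> 0 <= rp ->
  0 <= rq -> 0 <= rr ->
  (pp + qq < +oo -> 0 <= pp + qq - (pq + qp)) ->
  pp + pr + (rp + rr) < +oo -> qq + qr + (rq + rr) < +oo ->
  pq + pr + (rq + rr) < +oo.
Proof.
move=> pp0 pq0 pr0 qp0 qq0 qr0 rp0 rq0 rr0 spd.
rewrite !ge0_adde_lty ?adde_ge0// => /andP[/andP[ppy ->] /andP[_ ->]].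
move=> /andP[/andP[qqy _] /andP[-> _]]; rewrite !andbT.
(* If [pq + qp] were infinite, the difference in [spd] would be -oo, against its nonnegativity. *)
have {}spd : pq + qp <= pp + qq.
  have [pqy|pqy] := eqVneq (pq + qp) +oo; last first.
    rewrite -suber_ge0 ?spd ?ge0_adde_lty ?ppy//.
    by rewrite ge0_fin_numE ?adde_ge0// ltey.
  by move: spd; rewrite pqy addeNy leeNy_eq ge0_adde_lty// ppy qqy => /(_ isT).
have : pq + qp < +oo by rewrite (le_lt_trans spd)// ge0_adde_lty// ppy.
by rewrite ge0_adde_lty// => /andP[].
Qed.

(** Once all nine energies are real, every term involving [r] occurs on both sides of the
    inequality. *)
Lemma cancel_common_energy (R : realFieldType)
    (pp pq pr qp qq qr rp rq rr : \bar R) :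
  0 <= pp -> 0 <= pq -> 0 <= pr -> 0 <= qp -> 0 <= qq -> 0 <= qr -> 0 <= rp ->
  0 <= rq -> 0 <= rr ->
  pp + pr + (rp + rr) < +oo -> qq + qr + (rq + rr) < +oo ->
  pq + pr + (rq + rr) < +oo -> qp + qr + (rp + rr) < +oo ->
  (pp + pr + (rp + rr)) + (qq + qr + (rq + rr)) <=
    (pq + pr + (rq + rr)) + (qp + qr + (rp + rr)) ->
  pp + qq < +oo /\ pp + qq - (pq + qp) <= 0.
Proof.
move=> pp0 pq0 pr0 qp0 qq0 qr0 rp0 rq0 rr0.
rewrite !ge0_adde_lty ?adde_ge0// => /andP[/andP[ppy pry] /andP[rpy rry]].
move=> /andP[/andP[qqy qry] /andP[rqy _]] /andP[/andP[pqy _] _].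
move=> /andP[/andP[qpy _] _].
case: pp pp0 ppy => // pp _ _; case: pq pq0 pqy => // pq _ _.
case: pr pr0 pry => // pr _ _; case: qp qp0 qpy => // qp _ _.
case: qq qq0 qqy => // qq _ _; case: qr qr0 qry => // qr _ _.
case: rp rp0 rpy => // rp _ _; case: rq rq0 rqy => // rq _ _.
case: rr rr0 rry => // rr _ _.
rewrite -!EFinD !lee_fin => le_energy; split; first by rewrite !ltry.
by lra.
Qed.

Section strict_positivity.
Context (R : realType) (X : ptopologicalType) (k : X * X -> \bar R).
Hypothesis hausdorffX : hausdorff_space X.
Hypothesis mk :
  measurable_fun [set: borel X * borel X] (k : borel X * borel X -> \bar R).
Hypothesis k_ge0 : forall p, 0 <= k p.
Hypothesis spdk : strictly_positive_definite k.
Local Notation meas := {measure set (borel X) -> \bar R}.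
Local Notation energy := (mutual_energy k).
Implicit Types m n : meas.

Let energy_ge0 m n : 0 <= energy m n := mutual_energy_ge0 k_ge0 m n.

Lemma jordan_radon_measures m n : m setT < +oo -> n setT < +oo ->
  radon m -> radon n ->
  exists (g : signed_radon R X) (r : meas),
    [/\ measure_sum m (pos_part g) r, measure_sum n (neg_part g) r,
        pos_part g setT < +oo, neg_part g setT < +oo & r setT < +oo].
Proof.
move=> mT nT rm rn.
have [p [q [r [mE nE pq]]]] := jordan_finite_measures mT nT.
have rp : radon p.
  by apply: (radon_le hausdorffX mT) rm => B; exact: measure_sum_le mE.
have rq : radon q.
  by apply: (radon_le hausdorffX nT) rn => B; exact: measure_sum_le nE.
move: mT nT; rewrite mE// nE// !ge0_adde_lty// => /andP[pT rT] /andP[qT _].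
by exists (SignedRadon rp rq pq), r.
Qed.

Lemma energyDD m m1 m2 n n1 n2 : m1 setT < +oo -> m2 setT < +oo ->
  measure_sum m m1 m2 -> measure_sum n n1 n2 ->
  energy m n = energy m1 n1 + energy m1 n2 + (energy m2 n1 + energy m2 n2).
Proof.
move=> m1T m2T mE nE; rewrite (mutual_energyDl mk k_ge0 _ m1T m2T mE).
by rewrite !(mutual_energyDr k_ge0 _ nE).
Qed.

(** The terms involving [r] are already part of the energies of [m] and [n]; the remaining one,
    between the Jordan parts of [m - n], is bounded by positivity of the signed energy. *)
Lemma mutual_energy_lty m n : m setT < +oo -> n setT < +oo ->
  radon m -> radon n -> energy m m < +oo -> energy n n < +oo ->
  energy m n < +oo.
Proof.
move=> mT nT rm rn.
have [g [r [mE nE pT qT rT]]] := jordan_radon_measures mT nT rm rn.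
rewrite (energyDD pT rT mE mE) (energyDD qT rT nE nE) (energyDD pT rT mE nE).
apply: (cross_energy_lty (qp := energy (neg_part g) (pos_part g))) => //.
move=> fin_pos; have wd : energy_well_defined k g by left.
by have [ge0 _] := spdk wd; exact: ge0.
Qed.

(* The common part [r] of [m] and [n] cancels, so the hypothesis says that the
   energy of the signed measure [m - n] is nonpositive. *)
Lemma mutual_energy_eq m n : m setT < +oo -> n setT < +oo ->
  radon m -> radon n -> energy m m < +oo -> energy n n < +oo ->
  energy m m + energy n n <= energy m n + energy n m ->
  forall B, measurable B -> m B = n B.
Proof.
move=> mT nT rm rn mm nn.
move: (mutual_energy_lty mT nT rm rn mm nn).
move: (mutual_energy_lty nT mT rn rm nn mm).
move: mm nn; have [g [r [mE nE pT qT rT]]] := jordan_radon_measures mT nT rm rn.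
rewrite (energyDD pT rT mE mE) (energyDD qT rT nE nE).
rewrite (energyDD pT rT mE nE) (energyDD qT rT nE mE) => mm nn nm mn le_mn.
have [//|//|//|//|//|//|//|//|//|fin_pos le0] :=
  cancel_common_energy _ _ _ _ _ _ _ _ _ mm nn mn nm le_mn.
have wd : energy_well_defined k g by left.
have [_ pos] := spdk wd.
have null_g : null_signed g.
  by apply: contrapT => /pos; rewrite ltNge => /negP; exact.
by move=> B mB; have [pB qB] := null_g B mB; rewrite mE// nE// pB qB.
Qed.

End strict_positivity.

(** * Vectors of measures and the Gauss functional *)

Section vector_measures.
Context (R : realType) (X : ptopologicalType) (k : X * X -> \bar R).
Hypothesis hausdorffX : hausdorff_space X.
Hypothesis mk :
  measurable_fun [set: borel X * borel X] (k : borel X * borel X -> \bar R).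
Hypothesis k_ge0 : forall p, 0 <= k p.
Local Notation meas := {measure set (borel X) -> \bar R}.
Local Notation energy := (mutual_energy k).
Implicit Types m n : meas.

Lemma carried_finite (A : set (borel X)) m (a : R) : measurable A ->
  m.-negligible (~` A) -> m A = a%:E -> m setT < +oo.
Proof.
move=> mA [N [mN N0 AN]] mAa; have <- : A `|` N = setT.
  by apply/seteqP; split=> // x _; have [|/AN] := pselect (A x); [left|right].
apply: (@le_lt_trans _ _ (m A + m N)); first exact: measureU2.
by rewrite mAa N0 adde0 ltry.
Qed.

(** This provides the two positive measures whose difference is [R lam - R lam'], with their
    energies expanded. *)
Lemma big_measure_sum (I : Type) (r : seq I) (F : I -> meas) :
  (forall i, F i setT < +oo) -> (forall i, radon (F i)) ->
  exists m, [/\ m setT < +oo, radon m,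
    forall B, measurable B -> m B = \sum_(i <- r) F i B,
    forall n, energy m n = \sum_(i <- r) energy (F i) n &
    forall n, energy n m = \sum_(i <- r) energy n (F i)].
Proof.
move=> FT rF; elim: r => [|i r [m [mT rm mE mEl mEr]]].
  have zT : mzero [set: borel X] < +oo :> \bar R by exact: ltry.
  exists mzero; split => //.
  - apply/(finite_radonP hausdorffX) => // B e mB e0; exists set0.
    by split; [exact: compact0|exact: sub0set|rewrite /mzero lee_fin ltW].
  - by move=> B _; rewrite big_nil.
  - move=> n; rewrite big_nil /mutual_energy.
    by under eq_integral do rewrite integral_measure_zero; rewrite integral0.
  - by move=> n; rewrite big_nil /mutual_energy integral_measure_zero.
pose mi : meas := measure_add (F i) m.
have miE : measure_sum mi (F i) m by move=> B _; exact: measure_addE.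
exists mi; split.
- by rewrite miE// lte_add_pinfty.
- exact: (radon_sum hausdorffX (FT i) mT miE).
- by move=> B mB; rewrite miE// mE// big_cons.
- by move=> n; rewrite (mutual_energyDl mk k_ge0 _ (FT i) mT miE) mEl big_cons.
- by move=> n; rewrite (mutual_energyDr k_ge0 _ miE) mEr big_cons.
Qed.

Lemma vector_energyE (I : finType) (s : I -> R) (F : I -> meas)
    (e : I -> I -> R) :
  (forall i j, energy (F i) (F j) = (e i j)%:E) ->
  vector_energy k s F = (\sum_i \sum_j s i * s j * e i j)%:E.
Proof.
move=> eE; rewrite /vector_energy -sumEFin; apply: eq_bigr => i _.
by rewrite -sumEFin; apply: eq_bigr => j _; rewrite eE EFinM.
Qed.

Lemma gaussE (I : finType) (s : I -> R) (f : I -> X -> \bar R) (F : I -> meas)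
    (e : I -> I -> R) (g : I -> R) :
  (forall i j, energy (F i) (F j) = (e i j)%:E) ->
  (forall i, \int[F i]_x f i x = (g i)%:E) ->
  gauss k s f F = (\sum_i \sum_j s i * s j * e i j + 2 * \sum_i g i)%:E.
Proof.
move=> eE gE; rewrite /gauss (vector_energyE _ eE).
by rewrite (eq_bigr _ (fun i _ => gE i)) sumEFin -EFinM -EFinD.
Qed.

Lemma gauss_fin_num_integral (I : finType) (s : I -> R) (f : I -> X -> \bar R)
    (F : I -> meas) i :
  gauss k s f F \is a fin_num -> \int[F i]_x f i x \is a fin_num.
Proof.
rewrite /gauss fin_numD => /andP[_].
(* The factor 2 is turned into a sum because a sum in [\bar R] is finite only if each term is. *)
have -> : 2%:E * \sum_(i : I) \int[F i]_x f i x =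
  \sum_(i : I) \int[F i]_x f i x + \sum_(i : I) \int[F i]_x f i x.
  by rewrite mule_natl.
rewrite fin_numD andbb => /sum_fin_numP; exact.
Qed.

End vector_measures.

(** * The midpoint of two admissible vectors *)

Lemma eq_half (R : realFieldType) (x : \bar R) (r : R) :
  x + x = r%:E -> x = (r / 2)%:E.
Proof. by case: x => // x [<-]; congr EFin; lra. Qed.

Lemma leeDxx (R : realDomainType) (x y : \bar R) : x + x <= y + y -> x <= y.
Proof. by rewrite !leNgt; apply: contra => yx; exact: lteD. Qed.

Section midpoint.
Context (R : realType) (X : ptopologicalType) (k : X * X -> \bar R).
Hypothesis hausdorffX : hausdorff_space X.
Hypothesis mk :
  measurable_fun [set: borel X * borel X] (k : borel X * borel X -> \bar R).
Hypothesis k_ge0 : forall p, 0 <= k p.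
Local Notation meas := {measure set (borel X) -> \bar R}.
Local Notation energy := (mutual_energy k).
Implicit Types m n : meas.

(** The midpoint is known only through [h + h = m + n], so additivity in the measure applies to it,
    and its energies and integrals come from halving. *)
Lemma midpoint_exists m n : exists h : meas,
  measure_sum (measure_add m n : meas) h h.
Proof.
have half_ge0 : (0 <= 2^-1 :> R)%R by rewrite invr_ge0.
exists (mscale (NngNum half_ge0) (measure_add m n)) => B mB.
rewrite /= /mscale /= -ge0_muleDl ?lee_fin// -EFinD.
by rewrite (_ : 2^-1 + 2^-1 = 1)%R ?mul1e//; lra.
Qed.

Context (I : finType) (A : I -> set X) (s a : I -> R) (f : I -> X -> \bar R)
  (xi : I -> option meas).
Context (lam : bool -> I -> meas) (e : bool -> bool -> I -> I -> R).
Hypothesis mA : forall i, measurable (A i : set (borel X)).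
Hypothesis lam_adm : forall b, admissible k A s a f xi (lam b).
Hypothesis eE : forall b c i j, energy (lam b i) (lam c j) = (e b c i j)%:E.

Lemma admissible_finite b i : lam b i setT < +oo.
Proof.
have [/(_ i)[[_ neg] _] /(_ i) mass _ _] := lam_adm b.
exact: carried_finite neg mass.
Qed.

(** The mutual energy of the signed measures [R (lam b)] and [R (lam c)]. *)
Let q b c := (\sum_i \sum_j s i * s j * e b c i j)%R.

Lemma midpoint_admissible : exists mid, exists L : bool -> R,
  [/\ admissible k A s a f xi mid,
      forall b, gauss k s f (lam b) = (q b b + 2 * L b)%:E &
      gauss k s f mid =
        ((q true true + q true false + q false true + q false false) / 4 +
          (L true + L false))%:E].
Proof.
have lamT := admissible_finite.
have [mid midE] := choice (fun i => midpoint_exists (lam true i) (lam false i)).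
pose S i : meas := measure_add (lam true i) (lam false i).
have SE i : measure_sum (S i) (lam true i) (lam false i).
  by move=> B _; exact: measure_addE.
have {}midE i : measure_sum (S i) (mid i) (mid i) by exact: midE.
have ST i : S i setT < +oo by rewrite SE// lte_add_pinfty.
have midT i : mid i setT < +oo.
  by apply: le_lt_trans (ST i); exact: measure_sum_le (midE i) _.
have mid_e i j : energy (mid i) (mid j) =
    ((e true true i j + e true false i j +
      (e false true i j + e false false i j)) / 2 / 2)%:E.
  (* Four copies of the midpoint energy make up the energy of [S i] and [S j], hence two
     halvings. *)
  apply/eq_half/eq_half; rewrite -(energyDD mk k_ge0 _ _ (midE i) (midE j))//.
  by rewrite (energyDD mk k_ge0 _ _ (SE i) (SE j))// !eE.
have lam_int b i : \int[lam b i]_x f i x \is a fin_num.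
  by have [_ _ _ /gauss_fin_num_integral] := lam_adm b; exact.
pose g b i := fine (\int[lam b i]_x f i x).
have gE b i : \int[lam b i]_x f i x = (g b i)%:E by rewrite fineK.
have mid_int i : \int[mid i]_x f i x = ((g true i + g false i) / 2)%:E.
  have S_int : \int[S i]_x f i x = (g true i + g false i)%:E.
    by rewrite (integral_measure_sum2 (SE i))// !gE.
  (* Additivity needs finite integrals against [mid i]; these follow backwards from finiteness
     against [S i]. *)
  have : \int[S i]_x f i x \is a fin_num by rewrite S_int.
  rewrite (integral_measure_sum2_fin_num _ (midE i)) andbb => mid_fin.
  by apply: eq_half; rewrite -S_int (integral_measure_sum2 (midE i)).
have gauss_mid := gaussE s mid_e mid_int.
exists mid, (fun b => \sum_i g b i)%R; split.
- split => [i|i|i|].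
  + have [/(_ i)[[r1 [N1 [mN1 N10 AN1]]] _] _ _ _] := lam_adm true.
    have [/(_ i)[[r2 [N2 [mN2 N20 AN2]]] _] _ _ _] := lam_adm false.
    split; last by rewrite mid_e ltry.
    split.
      apply: (radon_le hausdorffX (ST i)) => [B mB|].
        exact: measure_sum_le (midE i) mB.
      exact: radon_sum (SE i) r1 r2.
    (* Each null set contains the complement of [A i]; their intersection is null for both vectors,
       hence for the midpoint. *)
    exists (N1 `&` N2); split; [exact: measurableI| |by rewrite subsetI].
    apply/eqP; rewrite eq_le measure_ge0 andbT; apply: leeDxx.
    rewrite -midE ?SE; [|exact: measurableI|exact: measurableI].
    have mN12 := measurableI _ _ mN1 mN2.
    by apply: leeD; [rewrite -[leRHS]N10|rewrite -[leRHS]N20];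
      apply: le_measure; rewrite ?inE.
  + have [_ /(_ i) m1 _ _] := lam_adm true.
    have [_ /(_ i) m2 _ _] := lam_adm false.
    have : mid i (A i) + mid i (A i) = (a i + a i)%:E.
      by rewrite -midE// SE// m1 m2.
    by move=> /eq_half ->; congr EFin; lra.
  + have [_ _ /(_ i) m1 _] := lam_adm true.
    have [_ _ /(_ i) m2 _] := lam_adm false.
    case: (xi i) m1 m2 => // x /= m1 m2 B mB; apply: leeDxx.
    by rewrite -midE// SE//; apply: leeD; [exact: m1|exact: m2].
  + by rewrite gauss_mid.
- by move=> b; rewrite (gaussE s (eE b b) (gE b)).
- rewrite gauss_mid; congr (_ + _)%:E; last first.
    by rewrite -big_split/= mulr_sumr; apply: eq_bigr => i _; lra.
  rewrite -!big_split/= mulr_suml; apply: eq_bigr => i _.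
  rewrite -!big_split/= mulr_suml; apply: eq_bigr => j _; lra.
Qed.

End midpoint.

(** * Signs, and uniqueness of the resultant *)

Lemma oppr1_eq1F (R : realFieldType) : (-1 == 1 :> R)%R = false.
Proof. by apply/lt_eqF; lra. Qed.

(* The difference [sum_i s_i (lam_i - lam'_i)] is written as a difference of
   two positive measures: a sign [-1] exchanges [lam] and [lam']. *)
Lemma sum_sign_split (R : realFieldType) (I : finType) (s : I -> R)
    (e : bool -> bool -> I -> I -> R) :
  (forall i, s i = 1 \/ s i = -1)%R ->
  let w i := s i == 1%R in
  let q b c := (\sum_i \sum_j s i * s j * e b c i j)%R in
  (\sum_i \sum_j e (w i) (w j) i j + \sum_i \sum_j e (~~ w i) (~~ w j) i j -
    (\sum_i \sum_j e (w i) (~~ w j) i j + \sum_i \sum_j e (~~ w i) (w j) i j) =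
   q true true + q false false - (q true false + q false true))%R.
Proof.
move=> s1 w q.
rewrite /q -!big_split -!sumrB /=; apply: eq_bigr => i _.
rewrite -!big_split -!sumrB /=; apply: eq_bigr => j _.
by rewrite /w; have [->|->] := s1 i; have [->|->] := s1 j;
  rewrite ?eqxx ?oppr1_eq1F /=; lra.
Qed.

Theorem lemma3p12 (R : realType) (X : ptopologicalType)
  (hausdorffX : hausdorff_space X)
  (locally_compactX : locally_compact [set: X])
  (metrizableX : metrizable R X)
  (countableX : countable_at_infinity X)
  (k : X * X -> \bar R)
  (kernelk : is_kernel k)
  (spdk : strictly_positive_definite k)
  (I : finType) (A : I -> set X) (s : I -> R)
  (condenserA : generalized_condenser A s)
  (capacityA : forall i, 0 < capacity k (A i))
  (a : I -> R) (a_gt0 : forall i, (0 < a i)%R)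
  (f : I -> X -> \bar R) (fieldf : external_field k A f)
  (xi : I -> option {measure set (borel X) -> \bar R})
  (constraintxi : is_constraint A a xi)
  (lam lam' : I -> {measure set (borel X) -> \bar R})
  (sol_lam : solutions k A s a f xi lam)
  (sol_lam' : solutions k A s a f xi lam') :
  R_equivalent s lam lam'.
Proof.
have [k_ge0 _ k_lsc] := kernelk.
have mk := lower_semicontinuous_prod_measurable
  (sigma_compact_metrizable_second_countable metrizableX countableX) k_lsc.
have [_ lcA s1 _] := condenserA.
have mA i : measurable (A i : set (borel X)).
  by have [lc _] := lcA i; exact: locally_closed_borel.
pose L b := if b then lam else lam'.
have L_sol b : solutions k A s a f xi (L b) by case: b.
have L_adm b : admissible k A s a f xi (L b) by have [] := L_sol b.
have LT := admissible_finite mA L_adm.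
have L_radon b i : radon (L b i) by have [/(_ i)[[]]] := L_adm b.
have L_energy b i : mutual_energy k (L b i) (L b i) < +oo.
  by have [/(_ i)[]] := L_adm b.
pose e b c i j := fine (mutual_energy k (L b i) (L c j)).
have eE b c i j : mutual_energy k (L b i) (L c j) = (e b c i j)%:E.
  rewrite fineK// ge0_fin_numE; first exact: mutual_energy_lty.
  exact: mutual_energy_ge0.
have [mid [g [mid_adm gaussL gauss_mid]]] :=
  midpoint_admissible hausdorffX mk k_ge0 mA L_adm eE.
have min_L b : gauss k s f (L b) <= gauss k s f mid.
  by have [_] := L_sol b; exact.
have := min_L true; have := min_L false.
rewrite !gaussL gauss_mid !lee_fin => min_false min_true.
pose w i := s i == 1%R.
have sum_e := sum_sign_split e s1.
(* [m] collects [lam i] where the sign is 1 and [lam' i] where it is -1, and [n] the other choices,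
   so [m - n] is [R lam - R lam']. *)
have [m [mT rm mE mEl mEr]] :=
  big_measure_sum hausdorffX mk k_ge0 (index_enum I)
  (fun i => LT (w i) i) (fun i => L_radon (w i) i).
have [n [nT rn nE nEl nEr]] :=
  big_measure_sum hausdorffX mk k_ge0 (index_enum I)
  (fun i => LT (~~ w i) i) (fun i => L_radon (~~ w i) i).
have sumE (u v : I -> bool) :
    \sum_i \sum_j mutual_energy k (L (u i) i) (L (v j) j) =
    (\sum_i \sum_j e (u i) (v j) i j)%:E.
  rewrite -sumEFin; apply: eq_bigr => i _.
  by rewrite -sumEFin; apply: eq_bigr => j _.
have mmE : mutual_energy k m m = (\sum_i \sum_j e (w i) (w j) i j)%:E.
  by rewrite mEl (eq_bigr _ (fun i _ => mEr _)) sumE.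
have mnE : mutual_energy k m n = (\sum_i \sum_j e (w i) (~~ w j) i j)%:E.
  by rewrite mEl (eq_bigr _ (fun i _ => nEr _)) (sumE w (fun j => ~~ w j)).
have nmE : mutual_energy k n m = (\sum_i \sum_j e (~~ w i) (w j) i j)%:E.
  by rewrite nEl (eq_bigr _ (fun i _ => mEr _)) (sumE (fun j => ~~ w j) w).
have nnE : mutual_energy k n n = (\sum_i \sum_j e (~~ w i) (~~ w j) i j)%:E.
  rewrite nEl (eq_bigr _ (fun i _ => nEr _)).
  by rewrite (sumE (fun j => ~~ w j) (fun j => ~~ w j)).
have mn_eq : forall B, measurable B -> m B = n B.
  apply: (mutual_energy_eq hausdorffX mk k_ge0 spdk) => //;
    rewrite ?mmE ?nnE ?ltry//.
  (* Adding [min_true] and [min_false] cancels the field terms and leaves [q true true + q false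
     false <= q true false + q false true]. *)
  rewrite mnE nmE -!EFinD lee_fin -subr_le0 sum_e; lra.
move=> B mB; have := mn_eq B mB; rewrite mE// nE//.
(* All masses are finite, so the equality of [m] and [n] can be rearranged in the reals into one
   between the resultants. *)
have fin b i : L b i B = (fine (L b i B))%:E.
  by rewrite fineK//; exact: fin_num_le_setT.
rewrite (eq_bigr _ (fun i _ => fin (w i) i)).
rewrite (eq_bigr _ (fun i _ => fin (~~ w i) i)).
rewrite !sumEFin => -[sumPN].
have rE b : Defs.resultant s (L b) B = (\sum_i s i * fine (L b i B))%:E.
  by rewrite /Defs.resultant -sumEFin; apply: eq_bigr => i _; rewrite EFinM -fin.
suff : Defs.resultant s (L true) B = Defs.resultant s (L false) B by [].
rewrite !rE; congr EFin; apply/eqP.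
rewrite -subr_eq0 -sumrB; move/eqP: sumPN; rewrite -subr_eq0 -sumrB.
apply: etrans; congr (_ == _); apply: eq_bigr => i _.
by rewrite /w; have [->|->] := s1 i; rewrite ?eqxx ?oppr1_eq1F /=; lra.
Qed.
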